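(* For every odd integer $n\geq 3$ and every positive even integer $k$ with $k<n$, \[ \Delta_{n,k}=\Delta_{n,k+1}. \] In other words, $\tilde{S}(n,k)$ is a positive multiple of $\Delta_{n,k+1}$.
   Context: $S(n,k)$ denotes the Stirling number of the second kind (the number of partitions of an $n$-element set into $k$ pairwise disjoint non-empty subsets), and $\tilde{S}(n,k)=k!\,S(n,k)$. For positive integers $k\leq n$, $\Delta_{n,k}$ denotes the greatest common divisor of the integers $\tilde{S}(n,j)$ for $j=k,k+1,\dots,n$. *)

(* Defs.v *)
From mathcomp Require Import all_boot.

Set Implicit Arguments.
Unset Strict Implicit.
Unset Printing Implicit Defensive.

Definition stirling2 (n k : nat) : nat :=
  #|[set P : {set {set 'I_n}} | partition P [set: 'I_n] & #|P| == k]|.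

Definition stirling2_tilde (n k : nat) : nat := k`! * stirling2 n k.

(* 0 is the neutral element of gcdn, so for k <= n this is exactly the gcd of
   the values at j = k, ..., n. *)
Definition Delta (n k : nat) : nat :=
  \big[gcdn/0]_(k <= j < n.+1) stirling2_tilde n j.

(* Main.v *)
(* The numbers a_j = j! S(n, j), j >= 1, are the coefficients of the polynomial
   G_n = sum_j a_j X^(j-1), which satisfies G_1 = 1 and
   G_(n+1) = ((X^2 + X) G_n)', so G_n(-1 - X) = (-1)^(n+1) G_n(X). For n odd,
   G_n is therefore an integral combination of powers of X^2 + X. If an integer
   divides all coefficients of such a polynomial in degrees >= 2e, it divides
   the coordinates on (X^2 + X)^i for i >= e (these powers are monic), and these
   are the only ones that contribute to the coefficient in degree 2e - 1. *)
Require Import Defs.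
From mathcomp Require Import all_boot.
From mathcomp Require Import all_algebra zify ring.

Import GRing.Theory Num.Theory.

Lemma eq_preim_partitionP (T : finType) (rT1 rT2 : eqType)
    (f : T -> rT1) (g : T -> rT2) (D : {set T}) :
  preim_partition f D = preim_partition g D <->
  {in D &, forall x y, (f x == f y) = (g x == g y)}.
Proof.
have eqvP (rT : eqType) (h : T -> rT) :
    {in D & &, equivalence_rel [rel x y | h x == h y]}.
  by move=> x y z _ _ _; split=> //= /eqP->.
split=> [eqfg x y Dx Dy | eqfg].
  have /= <- := pblock_equivalence_partition (eqvP _ f) Dx Dy.
  have /= <- := pblock_equivalence_partition (eqvP _ g) Dx Dy.
  by rewrite -![equivalence_partition _ D]/(preim_partition _ D) eqfg.
apply: eq_in_imset => x Dx; apply/setP=> y; rewrite !inE.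
by case Dy: (y \in D) => //=; rewrite eqfg.
Qed.

(** A function whose non-empty fibres are the blocks of [P] factors uniquely through the block map,
    as an injection from the blocks into [rT]; [lift] inverts this factorization. *)
Lemma card_preim_partition_eq (T rT : finType) (P : {set {set T}}) :
  partition P [set: T] ->
  #|[set f : {ffun T -> rT} | preim_partition f [set: T] == P]| =
  #|rT| ^_ #|P|.
Proof.
move=> partP; have [/eqP covP trivP P0] := and3P partP.
have PbP x : pblock P x \in P by rewrite pblock_mem // covP inE.
pose block := {B : {set T} | B \in P}.
pose bl x : block := exist _ (pblock P x) (PbP x).
have reprP (B : block) : exists x, x \in val B.
  by apply/set0Pn; apply: contraNneq P0 => <-; apply: valP.
pose rep B := xchoose (reprP B).
have repK B : bl (rep B) = B.
  by apply/val_inj/def_pblock=> //; [apply: valP | apply: xchooseP].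
pose lift (g : {ffun block -> rT}) : {ffun T -> rT} := [ffun x => g (bl x)].
have lift_inj : injective lift.
  move=> g h /ffunP eqgh; apply/ffunP=> B.
  by have := eqgh (rep B); rewrite !ffunE repK.
have fiberP (f : {ffun T -> rT}) :
    preim_partition f [set: T] = P <->
    forall x y, (f x == f y) = (pblock P x == pblock P y).
  have := eq_preim_partitionP _ _ _ f (pblock P) [set: T].
  rewrite preim_partition_pblock // => -[eqf fP].
  by split=> [/eqf eqfP x y | eqfP]; [apply: eqfP | apply: fP => x y _ _].
have <- : #|{: block}| = #|P| by rewrite card_sig; apply: eq_card.
rewrite -card_inj_ffuns -(card_imset _ lift_inj); apply: eq_card => f.
rewrite inE; apply/eqP/imsetP => [/fiberP eqf | [g]].
  exists [ffun B => f (rep B)].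
    rewrite inE; apply/injectiveP=> B C; rewrite !ffunE => /eqP.
    by rewrite eqf => /eqP eqBC; rewrite -(repK B) -(repK C); apply: val_inj.
  apply/ffunP=> x; rewrite !ffunE; apply/eqP.
  by rewrite eqf -[pblock P (rep _)]/(val (bl _)) repK.
rewrite inE => /injectiveP g_inj ->; apply/fiberP => x y.
by rewrite !ffunE (inj_eq g_inj).
Qed.

(** Maps from ['I_n] to ['I_x] are sorted by their fibre partition: one with k blocks arises from
    [x ^_ k] maps, which is k! times C(x, k). *)
Lemma sum_stirling2_tilde_bin (n x : nat) :
  \sum_(k < x.+1) stirling2_tilde n k * 'C(x, k) = x ^ n.
Proof.
have <- : #|{ffun 'I_n -> 'I_x}| = x ^ n by rewrite card_ffun !card_ord.
rewrite -sum1_card.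
rewrite (partition_big (fun f : {ffun 'I_n -> 'I_x} =>
  preim_partition f [set: 'I_n]) (fun P => partition P [set: 'I_n])) /=;
  last by move=> f _; apply: preim_partitionP.
transitivity (\sum_(k < x.+1) \sum_(P : {set {set 'I_n}} |
    partition P [set: 'I_n] && (#|P| == k)) x ^_ k).
  apply: eq_bigr => k _; rewrite sum_nat_const -bin_ffact.
  rewrite /stirling2_tilde mulnC mulnA mulnC.
  by congr (_ * _); apply: eq_card => P; rewrite !inE.
rewrite (exchange_big_dep (fun P => partition P [set: 'I_n])) /=; last first.
  by move=> k P _ /andP[].
apply: eq_bigr => P partP; rewrite partP /= sum1dep_card.
have := card_preim_partition_eq _ 'I_x _ partP; rewrite card_ord => ->.
(* A partition with more than x blocks matches no index k, and [x ^_ #|P|] is 0 as well. *)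
have [leqPx | ltxP] := ltnP #|P| x.+1.
  by rewrite (big_pred1 (Ordinal leqPx)) // => k; apply: eq_sym.
rewrite ffact_small // big1 // => k /eqP eqPk.
by have := ltn_ord k; rewrite -eqPk ltnNge ltxP.
Qed.

(** The recurrence for k! S(n, k), the number of surjections from n onto k elements. At k = 0 the
    factor k cancels the spurious [k.-1] term. *)
Fixpoint surj (n k : nat) : nat :=
  if n is m.+1 then k * (surj m k + surj m k.-1) else k == 0.

Lemma surjS n k : surj n.+1 k = k * (surj n k + surj n k.-1).
Proof. by []. Qed.

Lemma surj_gt0 n k : 0 < k <= n -> 0 < surj n k.
Proof.
elim: n k => [|n IHn] [|k] //= lekn; rewrite muln_gt0 addn_gt0 /=.
case: k lekn => [|k] lekn; last by rewrite [0 < surj n k.+1]IHn ?orbT.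
by case: n IHn lekn => //= n ->.
Qed.

Lemma surj_small n k : n < k -> surj n k = 0.
Proof.
elim: n k => [|n IHn] [|k] //= ltnk.
by rewrite !IHn ?muln0 // ltnW.
Qed.

(** Induction on n through x C(x, k) = k C(x, k) + (k + 1) C(x, k + 1). *)
Lemma sum_surj_bin n x : \sum_(k < x.+1) surj n k * 'C(x, k) = x ^ n.
Proof.
elim: n => [|n IHn].
  by rewrite big_ord_recl /= bin0 big1 // => i _; rewrite mul0n.
rewrite expnS -IHn big_distrr /=.
under eq_bigr do rewrite mulnDr mulnDl.
rewrite big_split /= [X in _ + X]big_ord_recl /= mul0n add0n.
(* The shifted sum gains a last term at i = x, which vanishes since C(x, x + 1) = 0. *)
have -> : \sum_(i < x) bump 0 i * surj n (bump 0 i).-1 * 'C(x, bump 0 i) =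
          \sum_(i < x.+1) surj n i * (i.+1 * 'C(x, i.+1)).
  rewrite big_ord_recr /= bin_small // !muln0 addn0.
  by apply: eq_bigr => i _; rewrite /bump /= mulnAC mulnC.
rewrite -big_split /=; apply: eq_bigr => k _.
have lekx : k <= x by rewrite -ltnS.
rewrite -[X in _ = X * _](subnKC lekx) mul_bin_left [RHS]mulnDl.
by congr (_ + _); [rewrite mulnA | apply: mulnCA].
Qed.

(** The system is triangular with diagonal entries C(x, x) = 1. *)
Lemma eq_sum_bin (u v : nat -> nat) :
  (forall x, \sum_(k < x.+1) u k * 'C(x, k) = \sum_(k < x.+1) v k * 'C(x, k)) ->
  u =1 v.
Proof.
move=> equv x; elim/ltn_ind: x => x IHx; move/eqP: (equv x).
rewrite !big_ord_recr /= binn !muln1.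
under eq_bigr do rewrite IHx //.
by rewrite eqn_add2l => /eqP.
Qed.

(** Comparing the two binomial expansions of [x ^ n] spares a proof of the recurrence on set
    partitions. *)
Lemma stirling2_tildeE n k : stirling2_tilde n k = surj n k.
Proof.
by apply: eq_sum_bin => x; rewrite sum_stirling2_tilde_bin sum_surj_bin.
Qed.

Local Open Scope ring_scope.

Definition refl_poly : {poly int} := - 'X - 1.

Definition XX1_poly : {poly int} := 'X ^+ 2 + 'X.

Lemma XX1_poly_refl : XX1_poly \Po refl_poly = XX1_poly.
Proof.
by rewrite /XX1_poly comp_polyD rmorphXn /= comp_polyX /refl_poly; ring.
Qed.

(** This is G_(m+1): the index is shifted so that the iteration starts from G_1 = 1. *)
Definition surj_poly (m : nat) : {poly int} :=
  iter m (fun p => (XX1_poly * p)^`()) 1.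

Lemma coef_surj_poly m i : (surj_poly m)`_i = (surj m.+1 i.+1)%:Z.
Proof.
elim: m i => [|m IHm] i.
  by rewrite coef1; case: i => //= i; rewrite muln0.
rewrite surjS PoszM PoszD coef_deriv -mulr_natl natz; congr (_ * _).
rewrite mulrC mulrDr expr2 mulrA coefD !coefMX IHm addrC.
by case: i => [|i]; rewrite ?IHm.
Qed.

(** By the chain rule each differentiation contributes a factor -1, the derivative of
    [refl_poly]. *)
Lemma surj_poly_refl m : surj_poly m \Po refl_poly = (-1) ^+ m *: surj_poly m.
Proof.
elim: m => [|m IHm]; first by rewrite scale1r comp_polyC.
rewrite -[surj_poly m.+1]/((XX1_poly * surj_poly m)^`()).
have := deriv_comp (XX1_poly * surj_poly m) refl_poly.
rewrite comp_polyM XX1_poly_refl IHm -scalerAr derivZ.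
rewrite derivB derivN derivX derivC.
by rewrite subr0 mulrN1 exprS mulN1r scaleNr => ->; rewrite opprK.
Qed.

(** In odd degree the substitution negates the leading coefficient, which would then equal its own
    opposite. *)
Lemma size_refl_invariant (p : {poly int}) :
  p \Po refl_poly = p -> p != 0 -> odd (size p).
Proof.
move=> p_refl p_neq0; apply: contraT => even_p.
have reflE : refl_poly = - ('X + 1%:P) by rewrite opprD.
have size_r : size refl_poly = 2%N by rewrite reflE size_polyN size_XaddC.
have := lead_coef_comp p (_ : 1 < size refl_poly)%N.
rewrite size_r p_refl => /(_ isT).
rewrite reflE lead_coefN lead_coefXaddC -signr_odd.
move: (p_neq0) (p_neq0); rewrite -{1}size_poly_gt0 -lead_coef_eq0.
case: (size p) even_p => //= m; rewrite negbK => -> _.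
by rewrite expr1 mulrN1 => /negPf lc_neq0 /eqP; rewrite eq_sym eqNr lc_neq0.
Qed.

Lemma refl_poly_coef_dvd (d : int) (e : nat) (p : {poly int}) :
  p \Po refl_poly = p -> (forall i, (e.*2 <= i)%N -> (d %| p`_i)%Z) ->
  (d %| p`_(e.*2.-1))%Z.
Proof.
have [n] := ubnP (size p); elim: n p => // n IHn p size_p p_refl dvd_p.
have [->|p_neq0] := eqVneq p 0; first by rewrite coef0 dvdz0.
have [s size_pE] : exists s, size p = s.*2.+1.
  exists (size p)./2; have := odd_double_half (size p).
  by rewrite size_refl_invariant.
have [ltse | leqes] := ltnP s e.
  by rewrite nth_default ?dvdz0 // size_pE; lia.
pose h := XX1_poly.
have h_monic : h \is monic.
  by rewrite monicE lead_coefDl ?lead_coefXn // size_polyX size_polyXn.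
have size_h : size h = 3%N by rewrite size_polyDl size_polyXn // size_polyX.
(* [q] is invariant and has the leading term of [p], in degree 2s >= 2e. So [d] divides all of [q],
   and [p - q] is a smaller instance. *)
pose q := lead_coef p *: h ^+ s.
have dvd_q i : (d %| q`_i)%Z.
  by rewrite coefZ dvdz_mulr // lead_coefE size_pE dvd_p //= leq_double.
have size_hs : size (h ^+ s) = s.*2.+1.
  have := size_exp h s; rewrite size_h.
  have := monic_neq0 (monic_exp s h_monic); rewrite -size_poly_gt0.
  by case: (size (h ^+ s)) => // t _ /= ->; rewrite mul2n.
have dvd_pq : (d %| (p - q)`_(e.*2.-1))%Z.
  apply: IHn => [||i lei].
  - apply: (@leq_ltn_trans s.*2); last by rewrite size_pE in size_p.
    apply/leq_sizeP => i lei; rewrite coefB coefZ.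
    have [->|neqis] := eqVneq i s.*2.
      have /monicP := monic_exp s h_monic; rewrite lead_coefE size_hs /= => ->.
      by rewrite mulr1 lead_coefE size_pE subrr.
    by rewrite !nth_default ?mulr0 ?subr0 // ?size_hs ?size_pE; lia.
  - by rewrite comp_polyB p_refl comp_polyZ rmorphXn /= XX1_poly_refl.
  - by rewrite coefB rpredB ?dvd_p ?dvd_q.
by rewrite -[p](subrK q) coefD rpredD.
Qed.

Close Scope ring_scope.

Theorem corollary1p2 (n k : nat) (n_odd : odd n) (n_ge3 : 3 <= n)
    (k_gt0 : 0 < k) (k_even : ~~ odd k) (k_lt_n : k < n) :
  Delta n k = Delta n k.+1 /\
  (exists m : nat, 0 < m /\ stirling2_tilde n k = m * Delta n k.+1).
Proof.
have dvdD j : k < j -> Delta n k.+1 %| surj n j.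
  (* Indices beyond n are included because the coefficient criterion asks for divisibility in every
     high degree. *)
  move=> ltkj; have [lejn|ltnj] := leqP j n; last by rewrite surj_small.
  rewrite -stirling2_tildeE /Delta big_geq_mkord.
  exact: (@biggcdn_inf _ (Ordinal (lejn : j < n.+1))).
have dvdDk : Delta n k.+1 %| stirling2_tilde n k.
  rewrite stirling2_tildeE.
  have [m def_n] : exists m, n = m.+1 by case: (n) n_ge3 => // m; exists m.
  have even_m : ~~ odd m by rewrite def_n in n_odd.
  have ksE : k = k./2.*2 by rewrite even_halfK.
  have := @refl_poly_coef_dvd (Posz (Delta n k.+1)) k./2 (surj_poly m).
  (* Degree i carries the value at j = i + 1, so degrees at least k give j > k, and degree k - 1
     gives j = k. *)
  rewrite -ksE !coef_surj_poly prednK // -def_n; apply.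
    by rewrite surj_poly_refl -signr_odd (negPf even_m) scale1r.
  by move=> i leki; rewrite coef_surj_poly -def_n; apply: dvdD.
split.
  rewrite {1}/Delta big_ltn; last exact: ltnW.
  exact/gcdn_idPr.
exists (stirling2_tilde n k %/ Delta n k.+1); rewrite divnK //; split=> //.
have tk_gt0 : 0 < stirling2_tilde n k.
  by rewrite stirling2_tildeE surj_gt0 // k_gt0 ltnW.
have D_gt0 := dvdn_gt0 tk_gt0 dvdDk.
by rewrite divn_gt0 //; exact: dvdn_leq tk_gt0 dvdDk.
Qed.
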